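(* Let $\mathrm{P}\in\mathcal{P}$ and let $(y_t)_{t\in\frac12\mathbb{Z}}$ and $(z_t)_{t\in\frac12\mathbb{Z}}$ be two $\mathrm{P}$-sequences (for the same $\mathrm{P}$). Then, for every integer $n\ge0$ and every $x \in \mathbb{C}$, $$\prod_{k=0}^{n-1}(x-z_k)=\sum_{k=0}^n\left[\begin{array}{c}n\\k\end{array}\right]_q q^{-k(n-k)/2}\prod_{j=0}^{k-1}(x-y_j)\prod_{j=0}^{n-k-1}\big(y_{k/2}-z_{j+\frac k2}\big).$$
   Context: $\mathcal{P}$ denotes the set of polynomials $\mathrm{P}(x,y)=x^2+y^2-2axy-2b(x+y)+c$ with $a,b,c\in\mathbb{C}$. A $\mathrm{P}$-sequence is a sequence of complex numbers $(x_t)$ indexed by $t\in\frac12\mathbb{Z}=\{k/2:k\in\mathbb{Z}\}$ such that $\mathrm{P}(x_t,y)=(y-x_{t+\frac12})(y-x_{t-\frac12})$ (as polynomials in $y$) for all $t\in\frac12\mathbb{Z}$. The parameter $\lambda\ne0$ is a complex number with $a=\frac12(\lambda+\lambda^{-1})$, and $q=\lambda^2$; the half-integer powers of $q$ are taken with $q^{1/2}=\lambda$, i.e. $q^{-k(n-k)/2}=\lambda^{-k(n-k)}$. The $q$-binomial coefficient is $$\left[\begin{array}{c}n\\k\end{array}\right]_q=\frac{(q;q)_n}{(q;q)_k(q;q)_{n-k}},\qquad (x;q)_n=\prod_{k=0}^{n-1}(1-q^kx),$$ with the obvious limiting values when the quotient is of the form $0/0$ (e.g. $q=1$), that is, it is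 regarded as a polynomial in $q$. Empty products equal 1. *)

(* Defs.v *)
From mathcomp Require Import all_boot all_order all_algebra polyXY.
From mathcomp Require Import reals complex.
Set Implicit Arguments.
Unset Strict Implicit.
Unset Printing Implicit Defensive.

Import Order.TTheory GRing.Theory Num.Theory.
Local Open Scope ring_scope.

(* Bivariate polynomials are elements of {poly {poly F}} with outer variable
   'X playing the role of x and 'Y := 'X%:P the role of y, so that P.[u%:P] is
   P(u, y) as a univariate polynomial in y. *)
Definition symP (F : fieldType) (a b c : F) : {poly {poly F}} :=
  'X ^+ 2 + 'Y ^+ 2 - (2 * a)%:P%:P * 'X * 'Y
  - (2 * b)%:P%:P * ('X + 'Y) + c%:P%:P.

(* A sequence (x_t) indexed by the half-integers t = m / 2 is encoded as
   s : int -> F with s m = x_{m/2}; hence x_{t + 1/2} = s (m + 1), and x_k for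
   an integer k is s (2 k). *)
Definition P_sequence (F : fieldType) (P : {poly {poly F}}) (s : int -> F) :
    Prop :=
  forall m : int,
    P.[(s m)%:P] = ('X - (s (m + 1))%:P) * ('X - (s (m - 1))%:P).

Definition qpoch (A : nzRingType) (x q : A) (n : nat) : A :=
  \prod_(k < n) (1 - q ^+ k * x).

(* The quotient is taken in F[X], where it is exact (qbinom_polyK), and only
   then evaluated at q; this gives the limiting values when q is a root of
   unity. *)
Definition qbinom_poly (F : fieldType) (n k : nat) : {poly F} :=
  qpoch 'X 'X n %/ (qpoch 'X 'X k * qpoch 'X 'X (n - k)%N).

Definition qbinom (F : fieldType) (n k : nat) (q : F) : F :=
  (qbinom_poly F n k).[q].

Lemma qpochS (F : fieldType) (n : nat) :
  qpoch 'X 'X n.+1 = qpoch 'X 'X n * (1 - 'X ^+ n.+1) :> {poly F}.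
Proof. by rewrite /qpoch big_ord_recr /= exprSr. Qed.

Lemma qpoch_dvdp (F : fieldType) (n k : nat) :
  (k <= n)%N ->
  qpoch 'X 'X k * qpoch 'X 'X (n - k)%N %| (qpoch 'X 'X n : {poly F}).
Proof.
elim: n k => [|n IHn] [|k] le_kn.
- by rewrite /qpoch big_ord0 mul1r dvdpp.
- by [].
- by rewrite subn0 {1}/qpoch big_ord0 mul1r dvdpp.
have {}le_kn : (k <= n)%N by [].
have -> : qpoch 'X 'X n.+1 = qpoch 'X 'X n * (1 - 'X ^+ k.+1)
    + qpoch 'X 'X n * (1 - 'X ^+ (n - k)) * 'X ^+ k.+1 :> {poly F}.
  rewrite qpochS -mulrA -mulrDr; congr (_ * _).
  rewrite mulrBl mul1r -exprD addnS subnK //.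
  by rewrite addrA subrK.
rewrite subSS; apply: dvdp_add.
  by rewrite qpochS mulrAC dvdp_mul ?IHn.
move: le_kn; rewrite leq_eqVlt => /orP[/eqP->|lt_kn].
  by rewrite subnn expr0 subrr mulr0 mul0r dvdp0.
have le_kn1 : (n - k.+1).+1 = (n - k)%N by rewrite subnS prednK ?subn_gt0.
apply: dvdp_mulr; rewrite -le_kn1 [X in _ * X]qpochS mulrA.
by rewrite dvdp_mul // IHn.
Qed.

Lemma qbinom_polyK (F : fieldType) (n k : nat) :
  (k <= n)%N ->
  qbinom_poly F n k * (qpoch 'X 'X k * qpoch 'X 'X (n - k)%N) = qpoch 'X 'X n.
Proof. by move=> le_kn; rewrite /qbinom_poly divpK ?qpoch_dvdp. Qed.

(* Main.v *)
(** In half-integer steps, put D(i, j) = y_i - z_j. Multiplying the degree-n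
    expansion by x - z_n and writing x - z_n = (x - y_k) + (y_k - z_n) in its k-th
    term reduces the theorem to a recurrence for the coefficients, which follows
    from two identities about D. The first one says that D behaves like a product
    f(i - j) g(i + j): exchanging the sums i + j between two factors does not change
    the product ([exchange]). The second one is a Pascal rule weighted by D
    ([coef_pascal]). Both are read off the explicit solutions of the linear
    recurrence x_{m+1} + x_{m-1} = 2 a x_m + 2 b: exponential in m if
    lambda^2 <> 1, and quadratic up to a sign if lambda^2 = 1; the polynomial P
    fixes the discriminant of the solution, so it is common to y and z. *)

Require Import Defs.
From mathcomp Require Import all_boot all_order all_algebra polyXY.
From mathcomp Require Import reals complex.
From mathcomp Require Import zify ring.
Set Implicit Arguments.
Unset Strict Implicit.
Unset Printing Implicit Defensive.
Import Order.TTheory GRing.Theory Num.Theory.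
Local Open Scope ring_scope.

(** * Gaussian binomials: vanishing outside the triangle, Pascal rules, value at 1 *)

Section QBinomial.
Variable F : fieldType.

Lemma qpoch_neq0 (n : nat) : qpoch 'X 'X n != 0 :> {poly F}.
Proof.
elim: n => [|n IHn]; first by rewrite /qpoch big_ord0 oner_neq0.
rewrite qpochS mulf_neq0 // -opprB oppr_eq0 monic_neq0 //.
exact: monicXnsubC.
Qed.

Lemma size_qpoch_lt (n m : nat) :
  (n < m)%N -> (size (qpoch 'X 'X n : {poly F}) < size (qpoch 'X 'X m : {poly F}))%N.
Proof.
elim: m => // m IHm; rewrite ltnS leq_eqVlt => le_nm.
have lt_m : (size (qpoch 'X 'X m : {poly F}) < size (qpoch 'X 'X m.+1 : {poly F}))%N.
  rewrite qpochS -opprB mulrN size_polyN size_Mmonic ?qpoch_neq0 ?monicXnsubC //.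
  by rewrite size_XnsubC // !addnS ltnS leq_addr.
by case/orP: le_nm => [/eqP-> // | /IHm lt_n]; apply: ltn_trans lt_m.
Qed.

Lemma qbinom_poly0 (n : nat) : qbinom_poly F n 0 = 1.
Proof. by rewrite /qbinom_poly subn0 {2}/qpoch big_ord0 mul1r divpp ?qpoch_neq0. Qed.

Lemma qbinom_polynn (n : nat) : qbinom_poly F n n = 1.
Proof. by rewrite /qbinom_poly subnn {3}/qpoch big_ord0 mulr1 divpp ?qpoch_neq0. Qed.

Lemma qbinom_poly_small (n k : nat) : (n < k)%N -> qbinom_poly F n k = 0.
Proof.
move=> lt_nk; rewrite /qbinom_poly divp_small //.
(* Here [n - k] truncates to 0, so the divisor is the q-Pochhammer polynomial of index [k], of
   larger degree than the dividend. *)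
rewrite (eqP (ltnW lt_nk : (n - k == 0)%N)) {3}/qpoch big_ord0 mulr1.
exact: size_qpoch_lt.
Qed.

(** Over the common denominator, with [u = 'X^(k.+1)] and [v = 'X^(n - k)], the rules are the two
    splittings of [1 - u * v]: as [(1 - u) + u * (1 - v)] and as [v * (1 - u) + (1 - v)]. *)
Lemma qbinom_poly_pascal (n k : nat) : (k <= n)%N ->
  qbinom_poly F n.+1 k.+1 = qbinom_poly F n k + 'X^(k.+1) * qbinom_poly F n k.+1
  /\ qbinom_poly F n.+1 k.+1 = 'X^(n - k) * qbinom_poly F n k + qbinom_poly F n k.+1.
Proof.
rewrite leq_eqVlt => /orP[/eqP->|lt_kn].
  by rewrite !qbinom_polynn qbinom_poly_small // subnn mulr0 mul1r addr0.
have [m def_n] : exists m, n = (k + m.+1)%N by exists (n - k.+1)%N; lia.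
have := @qbinom_polyK F n k; have := @qbinom_polyK F n k.+1.
have := @qbinom_polyK F n.+1 k.+1.
have -> : (n.+1 - k.+1 = m.+1)%N by lia.
have -> : (n - k.+1 = m)%N by lia.
have -> : (n - k = m.+1)%N by lia.
move=> /(_ ltac:(lia)) E /(_ ltac:(lia)) B /(_ ltac:(lia)) A.
have X_n1 : 'X^(n.+1) = 'X^(k.+1) * 'X^(m.+1) :> {poly F}.
  by rewrite -exprD; congr (_ ^+ _); lia.
move: E A B; rewrite !qpochS X_n1.
move: (qbinom_poly F n.+1 _) (qbinom_poly F n k.+1) (qbinom_poly F n k) => e b a.
move: (qpoch_neq0 k.+1) (qpoch_neq0 m.+1); rewrite !qpochS.
move: (qpoch _ _ n) (qpoch _ _ k) (qpoch _ _ m) => N K M.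
move: 'X^(k.+1) 'X^(m.+1) => u v K0 M0 E A B.
have cancel_qpoch (p r : {poly F}) :
    p * (K * (1 - u) * (M * (1 - v))) = r * (K * (1 - u) * (M * (1 - v))) -> p = r.
  by move/mulIf; apply; rewrite mulf_neq0.
have Nu : N * (1 - u) = a * (K * (1 - u) * (M * (1 - v))) by rewrite -A; ring.
have Nv : N * (1 - v) = b * (K * (1 - u) * (M * (1 - v))) by rewrite -B; ring.
split; apply: cancel_qpoch; rewrite E.
  by rewrite mulrDl -(mulrA u) -Nu -Nv; ring.
by rewrite mulrDl -(mulrA v) -Nu -Nv; ring.
Qed.

Lemma qbinom_pascal (n k : nat) (q : F) : (k <= n)%N ->
  qbinom n.+1 k.+1 q = qbinom n k q + q ^+ k.+1 * qbinom n k.+1 q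
  /\ qbinom n.+1 k.+1 q = q ^+ (n - k) * qbinom n k q + qbinom n k.+1 q.
Proof.
case/qbinom_poly_pascal; rewrite /qbinom => E1 E2.
by split; [rewrite E1 | rewrite E2]; rewrite !hornerE.
Qed.

Lemma qbinom_1 (n k : nat) : qbinom n k (1 : F) = 'C(n, k)%:R.
Proof.
elim: n k => [|n IHn] [|k]; rewrite ?bin0 ?bin0n.
- by rewrite /qbinom qbinom_poly0 hornerE.
- by rewrite /qbinom qbinom_poly_small ?horner0.
- by rewrite /qbinom qbinom_poly0 hornerE.
have [le_kn | lt_nk] := leqP k n; last first.
  by rewrite /qbinom qbinom_poly_small ?horner0 ?bin_small.
by have [-> _] := qbinom_pascal 1 le_kn; rewrite !IHn expr1n mul1r -natrD binS addnC.
Qed.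

End QBinomial.

(** * The expansion, derived from the two identities about differences *)

Section Exchange.
Variables (F : fieldType) (lambda : F) (y z : int -> F).
Hypothesis lambda_neq0 : lambda != 0.

(** The shift by [t] preserves the sum of the two indices, the shift by [r] their difference. *)
Definition exchange : Prop := forall i j r t : int,
  (y i - z j) * (y (i + r + t) - z (j + r - t)) =
  (y (i + t) - z (j - t)) * (y (i + r) - z (j + r)).

(** This is the coefficient recurrence for [n = k + m.+1] after cancelling the common product of
    differences and the common power of [lambda]. *)
Definition coef_pascal : Prop := forall k m : nat,
  qbinom (k + m.+1).+1 k.+1 (lambda ^+ 2) * (y k.+1 - z (2 * m + k.+1)%N) =
  lambda ^+ m.+1 * qbinom (k + m.+1) k (lambda ^+ 2) * (y (k%:Z - m%:Z) - z (k + m)%N)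
  + lambda ^+ k.+1 * qbinom (k + m.+1) k.+1 (lambda ^+ 2) *
    (y (2 * k.+1)%N - z (2 * (k + m.+1))%N).

Hypotheses (y_z_exchange : exchange) (y_z_pascal : coef_pascal).

Let diag_prod (m k : nat) : F := \prod_(j < m) (y k%:Z - z (2 * j + k)%N%:Z).

Let newton_coef (n k : nat) : F :=
  qbinom n k (lambda ^+ 2) * lambda ^- (k * (n - k)) * diag_prod (n - k) k.

(** The extra factor keeps index sum [2 * k] and moves outward with [m]: an exchange with [t = -1]
    turns it and the new last factor on the left into the next extra factor and the new last factor
    on the right. *)
Lemma diag_prod_shift (m k : nat) :
  diag_prod m.+1 k = diag_prod m k.+1 * (y (k%:Z - m%:Z) - z (k + m)%N).
Proof.
elim: m => [|m IHm].
  by rewrite /diag_prod big_ord1 big_ord0 mul1r subr0 muln0 addn0.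
rewrite {1}/diag_prod big_ord_recr /= -/(diag_prod _ _) IHm.
rewrite /diag_prod big_ord_recr /= -!mulrA.
congr (_ * _).
have := y_z_exchange (k%:Z - m%:Z) (k + m)%N%:Z m.+1%:Z (-1).
have -> : k%:Z - m%:Z + m.+1%:Z + -1 = k by lia.
have -> : (k + m)%N%:Z + m.+1%:Z - -1 = (2 * m.+1 + k)%N by lia.
have -> : k%:Z - m%:Z + -1 = k%:Z - m.+1%:Z by lia.
have -> : (k + m)%N%:Z - -1 = (k + m.+1)%N by lia.
have -> : k%:Z - m%:Z + m.+1%:Z = k.+1 by lia.
have -> : (k + m)%N%:Z + m.+1%:Z = (2 * m + k.+1)%N by lia.
by move->; rewrite mulrC.
Qed.

Lemma newton_coefS (n k : nat) : (k <= n)%N ->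
  newton_coef n.+1 k.+1 =
  newton_coef n k + (y (2 * k.+1)%N - z (2 * n)%N) * newton_coef n k.+1.
Proof.
rewrite leq_eqVlt => /orP[/eqP->|lt_kn].
  rewrite /newton_coef !subnn /qbinom !qbinom_polynn qbinom_poly_small // !muln0.
  by rewrite horner0 !mul0r mulr0 addr0 !hornerE /diag_prod !big_ord0.
have [m ->] : exists m, n = (k + m.+1)%N by exists (n - k.+1)%N; lia.
rewrite /newton_coef.
have -> : ((k + m.+1).+1 - k.+1 = m.+1)%N by lia.
have -> : (k + m.+1 - k.+1 = m)%N by lia.
have -> : (k + m.+1 - k = m.+1)%N by lia.
rewrite (diag_prod_shift m k) {1}/diag_prod big_ord_recr /= -/(diag_prod _ _).
have Pas := y_z_pascal k m.
(* The exponents [k * m.+1] and [k.+1 * m] fall short of [k.+1 * m.+1] by [m.+1] and [k.+1], whence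
   the powers of [lambda] in [coef_pascal]. *)
set e := lambda ^- (k.+1 * m.+1).
have -> : lambda ^- (k * m.+1) = e * lambda ^+ m.+1.
  by rewrite /e mulSn exprD invfM mulrAC mulVf ?expf_neq0 // mul1r.
have -> : lambda ^- (k.+1 * m) = e * lambda ^+ k.+1.
  by rewrite /e mulnS exprD invfM mulrAC mulVf ?expf_neq0 // mul1r.
transitivity (e * diag_prod m k.+1 * (qbinom (k + m.+1).+1 k.+1 (lambda ^+ 2) *
  (y k.+1 - z (2 * m + k.+1)%N))); first by ring.
by rewrite Pas; ring.
Qed.

Lemma newton_expansion (n : nat) (x : F) :
  \prod_(k < n) (x - z (2 * k)%N%:Z) =
  \sum_(k < n.+1) newton_coef n k * \prod_(j < k) (x - y (2 * j)%N%:Z).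
Proof.
elim: n => [|n IHn].
  rewrite big_ord0 big_ord1 /newton_coef /qbinom /diag_prod /= qbinom_poly0 !big_ord0.
  by rewrite expr0 invr1 !mulr1 hornerE.
rewrite big_ord_recr /= IHn mulr_suml.
pose Y k := \prod_(j < k) (x - y (2 * j)%N%:Z).
pose G k := (y (2 * k)%N%:Z - z (2 * n)%N%:Z) * newton_coef n k * Y k.
have stepE (k : nat) : newton_coef n k * Y k * (x - z (2 * n)%N%:Z) =
    newton_coef n k * Y k.+1 + G k.
  by rewrite /G {2}/Y big_ord_recr /= -/(Y k); ring.
rewrite (eq_bigr _ (fun (k : 'I_n.+1) _ => stepE k)) big_split /= addrC.
(* The sum may be extended to index [n.+1], where the q-binomial vanishes, and then split at index
   0. *)
have -> : \sum_(k < n.+1) G k = G 0%N + \sum_(k < n.+1) G k.+1.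
  transitivity (\sum_(k < n.+2) G k); last by rewrite big_ord_recl.
  rewrite [RHS]big_ord_recr /= /G /newton_coef /qbinom qbinom_poly_small //.
  by rewrite horner0 !(mul0r, mulr0) addr0.
rewrite [in RHS]big_ord_recl -addrA; congr (_ + _).
  rewrite /G /newton_coef /qbinom !qbinom_poly0 !mul0n !subn0 /diag_prod big_ord_recr /=.
  by rewrite addn0 muln0 /Y !big_ord0; ring.
rewrite -big_split /=; apply: eq_bigr => k _.
by rewrite newton_coefS -1?ltnS // mulrDl addrC.
Qed.

End Exchange.

(** * Recurrences of a P-sequence and their explicit solutions *)

Section ClosedForms.
Variable F : fieldType.

(** With [e = 2 * a], this and [quadratic_rec] are Vieta's formulas for the two roots in y of
    P([s m], y). *)
Definition linear_rec (e b : F) (s : int -> F) : Prop :=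
  forall m : int, s (m + 1) + s (m - 1) = e * s m + 2 * b.

Definition quadratic_rec (b c : F) (s : int -> F) : Prop :=
  forall m : int, s (m + 1) * s (m - 1) = s m ^+ 2 - 2 * b * s m + c.

Lemma symP_horner (a b c u v : F) :
  (symP a b c).[u%:P].[v] = u ^+ 2 + v ^+ 2 - 2 * a * u * v - 2 * b * (u + v) + c.
Proof.
rewrite /symP.
rewrite !(hornerD, hornerN, hornerM, hornerC, hornerX, horner_exp).
by [].
Qed.

Lemma P_sequence_rec (a b c : F) (s : int -> F) :
  P_sequence (symP a b c) s -> linear_rec (2 * a) b s /\ quadratic_rec b c s.
Proof.
move=> Ps.
(* The value at 0 gives the product of the roots; the value at 1 then gives their sum. *)
have ev (v : F) m : s m ^+ 2 + v ^+ 2 - 2 * a * s m * v - 2 * b * (s m + v) + c =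
    (v - s (m + 1)) * (v - s (m - 1)).
  by rewrite -symP_horner Ps !(hornerM, hornerD, hornerN, hornerX, hornerC).
have Q : quadratic_rec b c s.
  by move=> m; have := ev 0 m; rewrite !sub0r mulrNN => <-; ring.
split=> // m; have := ev 1 m; have := Q m => Qm E.
have -> : s (m + 1) + s (m - 1) =
    1 + s (m + 1) * s (m - 1) - (1 - s (m + 1)) * (1 - s (m - 1)).
  by ring.
by rewrite -E Qm; ring.
Qed.

Lemma linear_rec_uniq (e b : F) (s t : int -> F) :
  linear_rec e b s -> linear_rec e b t -> s 0 = t 0 -> s 1 = t 1 -> s =1 t.
Proof.
move=> Ls Lt st0 st1.
(* Two adjacent pairs of values are carried along, one moving up and one moving down. *)
suff st (n : nat) : [/\ s n = t n, s n.+1 = t n.+1, s (- n%:Z) = t (- n%:Z)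
    & s (1 - n%:Z) = t (1 - n%:Z)].
  by case=> n; [have [] := st n | rewrite NegzE; have [] := st n.+1].
elim: n => [|n [IH0 IH1 IHm IHm1]]; first by rewrite oppr0 subr0.
split=> //.
- have := Ls n.+1; have := Lt n.+1.
  have -> : n.+1%:Z + 1 = n.+2 by lia.
  have -> : n.+1%:Z - 1 = n by lia.
  by rewrite IH1 IH0 => <- /addIr.
- have := Ls (- n%:Z); have := Lt (- n%:Z).
  have -> : - n%:Z + 1 = 1 - n%:Z by lia.
  have -> : - n%:Z - 1 = - n.+1%:Z by lia.
  by rewrite IHm IHm1 => <- /addrI.
- by have -> : 1 - n.+1%:Z = - n%:Z by lia.
Qed.

Variable lambda : F.
Hypothesis lambda_neq0 : lambda != 0.

(** * Exponential solutions *)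

Section Exponential.
Hypothesis lambda2_neq1 : lambda ^+ 2 != 1.

Definition exponential_form (gamma K : F) (s : int -> F) : Prop :=
  exists alpha beta : F, alpha * beta = K /\
    forall m : int, s m = alpha * lambda ^ m + beta / lambda ^ m + gamma.

Lemma rec_exponential_form (b c : F) : exists gamma K : F, forall s : int -> F,
  linear_rec (lambda + lambda^-1) b s -> quadratic_rec b c s ->
  exponential_form gamma K s.
Proof.
have l1 : lambda - 1 != 0.
  by apply: contra_neq lambda2_neq1 => /subr0_eq ->; rewrite expr1n.
have l2 : lambda ^+ 2 - 1 != 0 by rewrite subr_eq0.
(* The constant solution of the linear recurrence. *)
pose gamma := - 2 * b * lambda / (lambda - 1) ^+ 2.
have gammaE : 2 * b = (2 - (lambda + lambda^-1)) * gamma.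
  by rewrite /gamma; field; rewrite l1 lambda_neq0.
(* Inserting the exponential form in [quadratic_rec] at 0 leaves [alpha * beta * (lambda -
   lambda^-1) ^+ 2 + 2 * b * gamma = c], which fixes [K] independently of [s]. *)
exists gamma, ((c - 2 * b * gamma) / (lambda - lambda^-1) ^+ 2) => s Ls Qs.
pose alpha := (lambda * (s 1 - gamma) - (s 0 - gamma)) / (lambda ^+ 2 - 1).
pose beta := s 0 - gamma - alpha.
have sE : s =1 fun m => alpha * lambda ^ m + beta / lambda ^ m + gamma.
  apply: (linear_rec_uniq Ls) => [m||].
  - rewrite !expfzDr // expr1z exprN1 gammaE.
    have := expfz_neq0 m lambda_neq0; move: (lambda ^ m) => u u0.
    by field; rewrite u0 lambda_neq0.
  - by rewrite expr0z /beta; field; rewrite ?oner_neq0.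
  - by rewrite expr1z /beta /alpha; field; rewrite l2 lambda_neq0.
exists alpha, beta; split=> //.
have ll0 : lambda - lambda^-1 != 0.
  have -> : lambda - lambda^-1 = (lambda ^+ 2 - 1) / lambda by field.
  by rewrite mulf_neq0 ?invr_eq0.
apply: (mulIf (expf_neq0 2 ll0)); rewrite divfK ?expf_neq0 //.
have := Qs 0; rewrite !sE add0r sub0r expr0z expr1z exprN1 !invrK => Q0.
have -> : c = (alpha * lambda + beta / lambda + gamma) *
    (alpha / lambda + beta * lambda + gamma) - (alpha + beta + gamma) ^+ 2
    + 2 * b * (alpha + beta + gamma).
  by move: Q0; rewrite mulr1 divr1 => ->; ring.
by rewrite gammaE; field.
Qed.

Lemma exponential_exchange (gamma K : F) (y z : int -> F) :
  exponential_form gamma K y -> exponential_form gamma K z -> exchange y z.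
Proof.
move=> [al [be [Ky yE]]] [al' [be' [Kz zE]]] i j r t.
rewrite !yE !zE !expfzDr // -!invr_expz.
have := expfz_neq0 i lambda_neq0; have := expfz_neq0 j lambda_neq0.
have := expfz_neq0 r lambda_neq0; have := expfz_neq0 t lambda_neq0.
move: (lambda ^ i) (lambda ^ j) (lambda ^ r) (lambda ^ t) => u w p v v0 p0 w0 u0.
(* Only the products of opposite exponentials survive in the difference of the two sides, and they
   agree since [K] is shared. *)
apply: subr0_eq; transitivity ((al * be - al' * be') *
  (p * v + (p * v)^-1 - p / v - v / p)); last by rewrite Ky Kz subrr mul0r.
by field; rewrite u0 w0 p0 v0.
Qed.

Lemma exponential_pascal (gamma K : F) (y z : int -> F) :
  exponential_form gamma K y -> exponential_form gamma K z ->
  coef_pascal lambda y z.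
Proof.
move=> [al [be [Ky yE]]] [al' [be' [Kz zE]]] k m.
have [E1 E2] := @qbinom_pascal F (k + m.+1) k (lambda ^+ 2) (leq_addr _ _).
rewrite addKn in E2.
rewrite !yE !zE.
have -> : (2 * m + k.+1 = m + m + k.+1)%N by lia.
have -> : (2 * k.+1 = k.+1 + k.+1)%N by lia.
have -> : (2 * (k + m.+1) = k.+1 + k.+1 + m + m)%N by lia.
rewrite expfzDr // -invr_expz -!exprnP.
move: E1 E2; rewrite -!exprM !mul2n -!addnn !exprD !exprS.
have := expf_neq0 k lambda_neq0; have := expf_neq0 m lambda_neq0.
move: (lambda ^+ k) (lambda ^+ m) => u v v0 u0.
move: (qbinom _ _ _) (qbinom _ k _) (qbinom _ _ _) => e a1 a2.
move=> E1 E2.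
transitivity ((al - al' * v ^+ 2) * (lambda * u) * a2
    + (be - be' / v ^+ 2) / (lambda * u) * a2).
  by field; rewrite u0 v0 lambda_neq0.
(* One Pascal rule serves the part in [al], [al'], the other the part in [be], [be']. *)
by rewrite {1}E1 E2; field; rewrite u0 v0 lambda_neq0.
Qed.

End Exponential.

(** * Signed quadratic solutions *)

Section Quadratic.
Hypothesis lambda2_eq1 : lambda ^+ 2 = 1.

(* Here lambda = 1 or lambda = -1; every such form below has d * lambda = d, so
   the square term only occurs when lambda = 1. *)
Definition quadratic_form (d delta K : F) (s : int -> F) : Prop :=
  exists beta gamma : F, 4 * d * gamma - beta ^+ 2 = K /\
    forall m : int, s m =
      lambda ^ m * (d * m%:~R ^+ 2 + beta * m%:~R + gamma) + delta.

Let lambdaV : lambda^-1 = lambda.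
Proof. by apply: (mulfI lambda_neq0); rewrite divff // -expr2. Qed.

Let lambdazV (m : int) : lambda ^ (- m) = lambda ^ m.
Proof. by rewrite -exprz_inv lambdaV. Qed.

Let lambdaz2 (m : int) : lambda ^ m * lambda ^ m = 1.
Proof. by rewrite -{1}lambdazV -expfzDr // addNr. Qed.

Let mulr_fixed (d : F) : d * lambda = d -> d = 0 \/ lambda = 1.
Proof.
move/eqP; rewrite -subr_eq0 -{2}[d]mulr1 -mulrBr mulf_eq0 subr_eq0.
by case/orP=> /eqP; [left | right].
Qed.

Lemma rec_quadratic_form (b c : F) : exists d delta K : F, d * lambda = d /\
  forall s : int -> F, linear_rec (lambda + lambda^-1) b s ->
  quadratic_rec b c s -> quadratic_form d delta K s.
Proof.
(* For [lambda = 1] the second difference is [2 * b], so [d = b]; for [lambda = -1] the constant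
   solution [delta] absorbs [b]. *)
have [d [delta [dl bE]]] : exists d delta : F, d * lambda = d /\
    delta * lambda = delta + d - b.
  have [-> | l1] := eqVneq lambda 1; first by exists b, 0; split; ring.
  have l1' : lambda - 1 != 0 by rewrite subr_eq0.
  by exists 0, (- b / (lambda - 1)); split; [ring | field].
have dlz (m : int) : d * lambda ^ m = d.
  by case: (mulr_fixed dl) => ->; rewrite ?mul0r // exp1rz mulr1.
(* The value of [K] is read off [quadratic_rec] at 0. *)
exists d, delta, (c - d ^+ 2 - 2 * delta * d - 2 * b * delta).
split=> // s Ls Qs; pose gamma := s 0 - delta.
pose beta := lambda * (s 1 - delta) - d - gamma.
have sE : s =1 fun m =>
    lambda ^ m * (d * m%:~R ^+ 2 + beta * m%:~R + gamma) + delta.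
  apply: (linear_rec_uniq Ls) => [m||].
  - have := bE; have := dlz (m + 1).
    rewrite !expfzDr // expr1z exprN1 lambdaV intrD intrB.
    clearbody beta gamma.
    move: (lambda ^ m) (m%:~R) beta gamma => u x be ga dlE ul.
    transitivity ((lambda + lambda) * (u * (d * x ^+ 2 + be * x + ga) + delta)
      + 2 * (d * (u * lambda)) + 2 * delta - 2 * (delta * lambda)); first by ring.
    by rewrite ul dlE; ring.
  - by rewrite expr0z /gamma; ring.
  - rewrite expr1z /beta.
    transitivity (lambda ^+ 2 * (s 1 - delta) + delta); last by ring.
    by rewrite lambda2_eq1; ring.
exists beta, gamma; split=> //.
have := Qs 0; rewrite !sE add0r sub0r expr0z expr1z exprN1 lambdaV.
rewrite mulr0z; clearbody beta gamma; move: beta gamma {sE} => be ga Q0.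
have -> : c = (lambda * (d + be + ga) + delta) * (lambda * (d - be + ga) + delta)
    - (ga + delta) ^+ 2 + 2 * b * (ga + delta).
  apply: (addrI ((ga + delta) ^+ 2 - 2 * b * (ga + delta))).
  transitivity ((1 * (d * 0 ^+ 2 + be * 0 + ga) + delta) ^+ 2 -
     2 * b * (1 * (d * 0 ^+ 2 + be * 0 + ga) + delta) + c); first by ring.
  by rewrite -Q0; ring.
transitivity (lambda ^+ 2 * ((d + ga) ^+ 2 - be ^+ 2) + 2 * delta * (d * lambda)
   + 2 * ga * (delta * lambda) + delta ^+ 2 - (ga + delta) ^+ 2 + 2 * b * (ga + delta)
   - d ^+ 2 - 2 * delta * d - 2 * b * delta); last by ring.
by rewrite lambda2_eq1 dl bE; ring.
Qed.

Lemma quadratic_exchange (d delta K : F) (y z : int -> F) : d * lambda = d ->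
  quadratic_form d delta K y -> quadratic_form d delta K z -> exchange y z.
Proof.
move=> dl [be [ga [Ky yE]]] [be' [ga' [Kz zE]]] i j r t.
rewrite !yE !zE !intrD !mulrNz !expfzDr // !lambdazV.
have := lambdaz2 i; have := lambdaz2 j; have := lambdaz2 t.
have Kyz : be ^+ 2 - be' ^+ 2 = 4 * d * (ga - ga').
  apply: subr0_eq.
  transitivity ((4 * d * ga' - be' ^+ 2) - (4 * d * ga - be ^+ 2)); first by ring.
  by rewrite Ky Kz subrr.
(* If [lambda = 1], the difference of the sides is a multiple of [Kyz]; if [d = 0], then [Kyz] says
   that the squares of [be] and [be'] agree, and the signs square to 1. *)
case: (mulr_fixed dl) => [d0 | ->]; last first.
  rewrite !exp1rz => _ _ _; apply: subr0_eq.
  set x := i%:~R; set w := j%:~R; set p := r%:~R; set v := t%:~R.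
  transitivity ((4 * d * (ga - ga') - (be ^+ 2 - be' ^+ 2)) * p * v); first by ring.
  by rewrite Kyz subrr !mul0r.
move: Kyz; rewrite d0.
move: (lambda ^ i) (lambda ^ j) (lambda ^ r) (lambda ^ t) => e g p v.
set x := i%:~R; set w := j%:~R; set rr := r%:~R; set tt := t%:~R => Kyz v2 g2 e2.
apply: subr0_eq.
transitivity (- p * v * rr * tt * ((e * e) * be ^+ 2 - (g * g) * be' ^+ 2)); first by ring.
by rewrite e2 g2 !mul1r Kyz; ring.
Qed.

(** At q = 1 the q-binomials are ordinary ones, every term carries the sign [lambda ^+ k.+1], and
    the two sides differ by a multiple of the relation [AB] between adjacent binomials. *)
Lemma quadratic_pascal (d delta K : F) (y z : int -> F) :
  quadratic_form d delta K y -> quadratic_form d delta K z ->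
  coef_pascal lambda y z.
Proof.
move=> [be [ga [Ky yE]]] [be' [ga' [Kz zE]]] k m.
rewrite lambda2_eq1 !qbinom_1 binS natrD.
have AB : 'C(k + m.+1, k)%:R * m.+1%:R = 'C(k + m.+1, k.+1)%:R * k.+1%:R :> F.
  by rewrite -!natrM; congr (_%:R); have := mul_bin_left (k + m.+1) k; lia.
have odd_pow : lambda ^ (2 * m + k.+1)%N = lambda ^+ k.+1.
  by rewrite mul2n -addnn PoszD expfzDr // PoszD expfzDr // lambdaz2 mul1r.
have even_pow (n : nat) : lambda ^ (2 * n)%N = 1.
  by rewrite mul2n -addnn PoszD expfzDr // lambdaz2.
have mix_add : lambda ^+ m.+1 * lambda ^ (k + m)%N = lambda ^+ k.+1.
  rewrite PoszD expfzDr // -!exprnP !exprS -[RHS]mulr1 -(lambdaz2 m) -exprnP.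
  by ring.
have mix_sub : lambda ^+ m.+1 * lambda ^ (k%:Z - m%:Z) = lambda ^+ k.+1.
  by rewrite expfzDr // lambdazV -expfzDr // -PoszD -exprnP.
have mix_pow P Q (A : F) : lambda ^+ m.+1 * A *
    (lambda ^ (k%:Z - m%:Z) * P + delta - (lambda ^ (k + m)%N * Q + delta)) =
    lambda ^+ k.+1 * A * (P - Q).
  transitivity (A * (lambda ^+ m.+1 * lambda ^ (k%:Z - m%:Z) * P
    - lambda ^+ m.+1 * lambda ^ (k + m)%N * Q)); first by ring.
  by rewrite mix_sub mix_add; ring.
rewrite !yE !zE odd_pow !even_pow -exprnP mix_pow intrB -!pmulrn.
move: AB; move: 'C(k + m.+1, k)%:R 'C(k + m.+1, k.+1)%:R => A B' AB.
apply: subr0_eq; transitivity (lambda ^+ k.+1 * (be - be' - 4 * d * m%:R) *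
  (A * m.+1%:R - B' * k.+1%:R)); first by ring.
by rewrite AB subrr mulr0.
Qed.

End Quadratic.

(** * Union of the two cases, and the theorem *)

Lemma P_sequence_exchange_pascal (a b c : F) (y z : int -> F) :
  2 * a = lambda + lambda^-1 ->
  P_sequence (symP a b c) y -> P_sequence (symP a b c) z ->
  exchange y z /\ coef_pascal lambda y z.
Proof.
move=> aE /P_sequence_rec[Ly Qy] /P_sequence_rec[Lz Qz]; rewrite aE in Ly Lz.
have [l2 | l2] := eqVneq (lambda ^+ 2) 1.
  have [d [delta [K [dl form]]]] := rec_quadratic_form l2 b c.
  have [Fy Fz] := (form y Ly Qy, form z Lz Qz).
  by split; [apply: quadratic_exchange dl Fy Fz | apply: quadratic_pascal Fy Fz].
have [gamma [K form]] := rec_exponential_form l2 b c.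
have [Fy Fz] := (form y Ly Qy, form z Lz Qz).
by split; [apply: exponential_exchange Fy Fz | apply: exponential_pascal Fy Fz].
Qed.

End ClosedForms.

Theorem theorem4p1 (R : realType) (a b c lambda : R[i])
    (y z : int -> R[i]) :
  lambda != 0 ->
  a = (lambda + lambda^-1) / 2 ->
  P_sequence (symP a b c) y ->
  P_sequence (symP a b c) z ->
  forall (n : nat) (x : R[i]),
    \prod_(k < n) (x - z (2 * k)%N%:Z) =
    \sum_(k < n.+1)
       qbinom n k (lambda ^+ 2) * lambda ^- (k * (n - k)) *
       (\prod_(j < k) (x - y (2 * j)%N%:Z)) *
       (\prod_(j < n - k) (y k%:Z - z (2 * j + k)%N%:Z)).
Proof.
move=> l0 aE Py Pz n x.
have a2 : 2 * a = lambda + lambda^-1 by rewrite aE mulrC divfK ?pnatr_eq0.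
have [ex pas] := P_sequence_exchange_pascal l0 a2 Py Pz.
rewrite (newton_expansion l0 ex pas); apply: eq_bigr => k _.
by rewrite [RHS]mulrAC.
Qed.
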